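(* Let $\kappa$ be a cardinal satisfying $cf(\kappa)>\omega_1$. Let $K$ be a scattered compact Hausdorff space of cardinality $\kappa$ (equivalently, such that $C(K)$ has density $\kappa$). Then the Banach space $C(K)$ does not admit an overcomplete set.
   Context: $C(K)$ is the real Banach space of real-valued continuous functions on $K$ with the supremum norm. $dens(X)$ (the density) is the minimal cardinality of a norm dense subset of a Banach space $X$; $cf(\kappa)$ is the cofinality of $\kappa$. A subset $Y$ of a Banach space $X$ is called overcomplete (in $X$) if $|Y|=dens(X)$ and every $Z\subseteq Y$ with $|Z|=|Y|$ is linearly dense in $X$ (its linear span is norm dense in $X$). A space is scattered if each of its nonempty subspaces has a relatively isolated point. *)

(* Defs.v *)
From HB Require Import structures.
From mathcomp Require Import all_boot all_order all_algebra.
From mathcomp Require Import all_classical all_reals.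
From mathcomp Require Import topology normedtype.
From mathcomp Require Import lra.

Set Implicit Arguments.
Unset Strict Implicit.
Unset Printing Implicit Defensive.

Import Order.TTheory GRing.Theory Num.Theory.
Import numFieldNormedType.Exports.

Local Open Scope classical_set_scope.
Local Open Scope card_scope.
Local Open Scope ring_scope.

Definition card_lt T U (A : set T) (B : set U) := (A #<= B) && ~~ (B #<= A).

Notation "A '#<' B" := (card_lt A B)
  (at level 79, format "A  '#<'  B") : card_scope.

(* The cardinal min {|A| : P A} is represented by a set of that cardinality;
   the choice of the set is immaterial up to #=. *)
Definition least_card T (P : set (set T)) : set T :=
  xget set0 [set A | P A /\ forall B, P B -> A #<= B].

Section least_card.
Variables (T : Type) (P : set (set T)).

Lemma least_card_ex :
  P !=set0 -> exists A, P A /\ forall B, P B -> A #<= B.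
Proof.
move=> [A0 PA0]; pose I := {A | P A}.
pose Q (S : set (I -> T)) :=
  (forall f i, S f -> sval i (f i)) /\
  (forall f g i, S f -> S g -> f i = g i -> f = g).
have [|S [[Sin Sinj] Smax]] := @Zorn_bigcup _ Q.
  move=> F FQ Ftot; split=> [f i [X FX Xf]|f g i [X FX Xf] [Y FY Yg] fg].
    exact: (FQ _ FX).1.
  have [XY|YX] := Ftot _ _ FX FY.
    by apply: ((FQ _ FY).2 _ _ i) => //; exact: XY.
  by apply: ((FQ _ FX).2 _ _ i) => //; exact: YX.
have [[i iS]|noi] :=
  pselect (exists i : I, sval i `<=` [set f i | f in S]).
  exists (sval i); split; first exact: svalP.
  move=> B PB; apply: card_le_trans (subset_card_le iS) _.
  pose j : I := exist _ B PB.
  have ij k : [set f k | f in S] #= S.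
    by apply: inj_card_eq => f g /set_mem Sf /set_mem Sg; exact: Sinj.
  rewrite (card_le_eql (ij i)) -(card_le_eql (ij j)).
  by apply: subset_card_le => _ [f Sf <-]; exact: (Sin f j).
have /choice[g gP] (i : I) : exists x, sval i x /\ ~ [set f i | f in S] x.
  apply: contrapT => h; apply: noi; exists i => x ix; apply: contrapT => nx.
  by apply: h; exists x.
exfalso; apply: (Smax (S `|` [set g])).
  split; first by move=> x Sx; left.
  move=> /(_ g (or_intror erefl)) Sg.
  by have [_] := gP (exist _ A0 PA0); apply; exists g.
split=> [f i [Sf|->]|f h i [Sf|->] [Sh|->] //].
- exact: Sin.
- exact: (gP i).1.
- exact: Sinj.
- by move=> fg; have [_ []] := gP i; exists f.
- by move=> gh; have [_ []] := gP i; exists h.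
Qed.

Lemma least_cardP : P !=set0 ->
  P (least_card P) /\ forall B, P B -> least_card P #<= B.
Proof.
move=> /least_card_ex[A PA]; rewrite /least_card.
by case: xgetP => [_ _ //|/(_ A)].
Qed.

End least_card.

(* A cardinal is an initial ordinal: a well-ordered set all of whose proper
   initial segments have strictly smaller cardinality. *)
Record cardinal := Cardinal {
  csort :> Type;
  cle : rel csort;
  cle_wo : wochoice.well_order cle;
  cle_initial : forall x, [set y | cle y x /\ y <> x] #< [set: csort] }.

Definition cofinal (kappa : cardinal) (A : set kappa) :=
  forall x, exists2 y, A y & cle x y.

Definition cof (kappa : cardinal) : set kappa := least_card (@cofinal kappa).
Arguments cof : clear implicits.

(* The least uncountable cardinal, realised as a subset of the power set of
   nat; this is possible as it is at most the continuum. *)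
Definition omega1 : set (set nat) := least_card [set W | ~ countable W].

Lemma omega1P : ~ countable omega1 /\
  forall W : set (set nat), ~ countable W -> omega1 #<= W.
Proof.
apply: (@least_cardP _ [set W | ~ countable W]); exists setT => /=.
move=> /pcard_injP[f inj].
pose D := [set n | exists2 A, f A = n & ~ A n].
have [DfD|nDfD] := pselect (D (f D)); last by apply: (nDfD); exists D.
by case: (DfD) => A /inj->; rewrite ?in_setT.
Qed.

Definition dens (X : topologicalType) : set X := least_card (@dense X).
Arguments dens : clear implicits.

Section banach.
Variable R : realType.

Definition lspan (X : lmodType R) (Z : set X) : set X :=
  [set v | exists n (c : 'I_n -> R) (z : 'I_n -> X),
     (forall i, Z (z i)) /\ v = \sum_(i < n) c i *: z i].

Definition linearly_dense (X : normedModType R) (Z : set X) := dense (lspan Z).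

Definition overcomplete (X : completeNormedModType R) (Y : set X) :=
  Y #= dens X /\
  forall Z : set X, Z `<=` Y -> Z #= Y -> linearly_dense Z.

End banach.

Definition scattered (K : topologicalType) :=
  forall A : set K, A !=set0 -> isolated A !=set0.

HB.mixin Record isCompact K of Topological K := {
  compactT : compact [set: K]
}.

#[short(type="compactType")]
HB.structure Definition Compact := {K of Topological K & isCompact K}.

Definition Cspace (R : realType) (K : compactType) : Type := continuousType K R.

Section Cspace.
Variables (R : realType) (K : compactType).

Local Notation CK := (Cspace R K).

Definition Cfun (f : CK) : K -> R := Continuous.sort f.
Coercion Cfun : Cspace >-> Funclass.

HB.instance Definition _ := Choice.copy CK (continuousType K R).

Implicit Types f g h : CK.

Lemma CspaceP f g : (forall x, f x = g x) -> f = g.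
Proof. by move=> fg; apply/continuousEP. Qed.

Lemma Cspace_continuous f : continuous (f : K -> R).
Proof. exact: cts_fun. Qed.

Definition Cmk (u : K -> R) (cu : continuous u) : CK :=
  (mkcts cu : continuousType K R).

Lemma cts0 : continuous (fun _ : K => 0 : R).
Proof. by move=> x; exact: cvg_cst. Qed.

Lemma ctsN f : continuous (fun x => - f x).
Proof. by move=> x; exact: (continuousN (@Cspace_continuous f x)). Qed.

Lemma ctsD f g : continuous (fun x => f x + g x).
Proof.
move=> x.
exact: (continuousD (@Cspace_continuous f x) (@Cspace_continuous g x)).
Qed.

Lemma ctsZ (a : R) f : continuous (fun x => a * f x).
Proof.
by move=> x; apply: continuousM; [exact: cvg_cst|exact: (@Cspace_continuous f)].
Qed.

Definition Czero := Cmk cts0.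
Definition Copp f := Cmk (@ctsN f).
Definition Cadd f g := Cmk (@ctsD f g).
Definition Cscale a f := Cmk (@ctsZ a f).

Lemma CaddA : associative Cadd.
Proof. by move=> f g h; apply: CspaceP => x; exact: addrA. Qed.
Lemma CaddC : commutative Cadd.
Proof. by move=> f g; apply: CspaceP => x; exact: addrC. Qed.
Lemma Cadd0 : left_id Czero Cadd.
Proof. by move=> f; apply: CspaceP => x; exact: add0r. Qed.
Lemma CaddN : left_inverse Czero Copp Cadd.
Proof. by move=> f; apply: CspaceP => x; exact: addNr. Qed.

HB.instance Definition _ := GRing.isZmodule.Build CK CaddA CaddC Cadd0 CaddN.

Lemma CscaleA a b f : Cscale a (Cscale b f) = Cscale (a * b) f.
Proof. by apply: CspaceP => x; exact: mulrA. Qed.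
Lemma Cscale1 : left_id 1 Cscale.
Proof. by move=> f; apply: CspaceP => x; exact: mul1r. Qed.
Lemma CscaleDr : right_distributive Cscale +%R.
Proof. by move=> a f g; apply: CspaceP => x; exact: mulrDr. Qed.
Lemma CscaleDl f : {morph Cscale^~ f : a b / a + b}.
Proof. by move=> a b; apply: CspaceP => x; exact: mulrDl. Qed.

HB.instance Definition _ :=
  GRing.Zmodule_isLmodule.Build R CK CscaleA Cscale1 CscaleDr CscaleDl.

(* sup set0 = 0, so this is also right for empty K. *)
Definition Cnorm f : R := sup [set `|f x| | x in [set: K]].

Lemma Cbounded f : exists M : R, forall x, `|f x| <= M.
Proof.
have /compact_bounded[M [_ fM]] : compact (f @` [set: K]).
  apply: continuous_compact; last exact: compactT.
  by apply: continuous_subspaceT; exact: Cspace_continuous.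
by exists (M + 1) => x; apply: fM; [rewrite ltrDl|exists x].
Qed.

Lemma Cnorm_ub f x : `|f x| <= Cnorm f.
Proof.
apply: ub_le_sup; last by exists x.
by have [M fM] := Cbounded f; exists M => _ [y _ <-].
Qed.

Lemma Cnorm_ge0 f : 0 <= Cnorm f.
Proof.
have [[x]|K0] := pselect (inhabited K).
  exact: le_trans (Cnorm_ub f x).
rewrite /Cnorm (_ : [set `|f x| | x in [set: K]] = set0) ?sup0//.
by apply/seteqP; split=> y //= [x]; case: K0.
Qed.

Lemma Cnorm_le f (M : R) : 0 <= M -> (forall x, `|f x| <= M) -> Cnorm f <= M.
Proof.
move=> M0 fM; have [[x]|K0] := pselect (inhabited K).
  by apply: ge_sup => [|_ [y _ <-]//]; exists `|f x|; exists x.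
rewrite /Cnorm (_ : [set `|f x| | x in [set: K]] = set0) ?sup0//.
by apply/seteqP; split=> y //= [x]; case: K0.
Qed.

Lemma CnormD f g : Cnorm (f + g) <= Cnorm f + Cnorm g.
Proof.
apply: Cnorm_le => [|x]; first by rewrite addr_ge0 ?Cnorm_ge0.
by apply: le_trans (ler_normD _ _) _; rewrite lerD ?Cnorm_ub.
Qed.

Lemma CnormZ a f : Cnorm (a *: f) = `|a| * Cnorm f.
Proof.
have le b g : Cnorm (b *: g) <= `|b| * Cnorm g.
  apply: Cnorm_le => [|x]; first by rewrite mulr_ge0 ?Cnorm_ge0.
  by rewrite [leLHS]normrM ler_wpM2l ?Cnorm_ub.
apply/eqP; rewrite eq_le le/=.
have [->|a0] := eqVneq a 0; first by rewrite normr0 mul0r Cnorm_ge0.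
rewrite -ler_pdivlMl ?normr_gt0// -normfV.
by have := le a^-1 (a *: f); rewrite scalerA mulVf// scale1r.
Qed.

Lemma Cnorm0_eq0 f : Cnorm f = 0 -> f = 0.
Proof.
move=> f0; apply: CspaceP => x; apply/eqP.
by rewrite -normr_le0 -f0 Cnorm_ub.
Qed.

HB.instance Definition _ :=
  Lmodule_isNormed.Build R CK CnormD CnormZ Cnorm0_eq0.

Lemma Cspace_complete (F : set_system CK) :
  ProperFilter F -> cauchy F -> cvg F.
Proof.
move=> FF /cauchyP Fc.
have FE (e : R) : 0 < e -> exists f, F [set g | forall x, `|f x - g x| < e].
  move=> /Fc [f Ff]; exists f; apply: filterS Ff => g.
  rewrite -ball_normE/= => fg x.
  exact: le_lt_trans (Cnorm_ub (f - g) x) fg.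
pose ev (x : K) (f : CK) : R := f x.
have Fx x : cvg (ev x @ F).
  apply/cauchy_cvgP/cauchyP => e /FE[f Ff].
  exists (f x).
  apply: (@filterS _ F _ _ (ev x @^-1` ball (f x) e) _ Ff) => h fh.
  exact: fh.
pose g x := lim (ev x @ F).
have gE (e : R) f x : F [set h | forall x, `|f x - h x| < e] ->
    `|f x - g x| <= e.
  move=> Ff; have fxg : (fun h => `|f x - ev x h|) @ F --> `|f x - g x|.
    by apply: cvg_norm; apply: cvgB; [exact: cvg_cst|exact: Fx].
  rewrite -(cvg_lim _ fxg)//; apply: limr_le; first exact: cvgP fxg.
  by apply: filterS Ff => h /(_ x)/ltW.
have gc : continuous g.
  move=> x; apply/cvgrPdist_le => e e0.
  have e3 : 0 < e / 3 by rewrite divr_gt0.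
  have [f Ff] := FE _ e3.
  have /cvgrPdist_le/(_ _ e3) := @Cspace_continuous f x.
  apply: filterS => y fxy.
  have -> : g x - g y = - (f x - g x) + (f x - f y) + (f y - g y).
    by rewrite opprB !subrKA.
  have -> : e = e / 3 + e / 3 + e / 3 by lra.
  apply: le_trans (ler_normD _ _) _; apply: lerD; last exact: gE.
  apply: le_trans (ler_normD _ _) _; apply: lerD => //.
  by rewrite normrN; exact: gE.
apply: (cvgP (Cmk gc)); apply/cvgrPdist_le => e e0.
have e2 : 0 < e / 2 by rewrite divr_gt0.
have [f Ff] := FE _ e2.
apply: filterS (Ff) => h fh.
apply: Cnorm_le => [|x]; first exact: ltW.
have -> : (Cmk gc - h : CK) x = - (f x - g x) + (f x - h x).
  by rewrite opprB subrKA.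
rewrite (splitr e); apply: le_trans (ler_normD _ _) _; apply: lerD.
  by rewrite normrN; exact: gE.
exact/ltW.
Qed.

HB.instance Definition _ := Uniform_isComplete.Build CK Cspace_complete.

End Cspace.

(* Main.v *)
(* Let Y be overcomplete in C(K). For x <> y in K, evaluation at x minus
   evaluation at y is a nonzero functional, so fewer than kappa elements of Y
   take the same value at x and at y. As cf(kappa) > omega_1, choosing omega_1
   points of K leaves an element of Y that takes distinct values at all of
   them. But a continuous real function on a scattered compact space has
   countable range.

   As for the density: a dense D gives the base {f > 1/2}, f in D, and a
   scattered space has at most as many points as any base; conversely the
   lattice generated by the functions q + r f_xy, with q, r rational and f_xy
   separating x from y, is dense by the Stone-Weierstrass argument. *)
Require Import Defs.
From mathcomp Require Import all_boot all_order all_algebra.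
From mathcomp Require Import all_classical all_reals.
From mathcomp Require Import topology normedtype.
From mathcomp Require Import lra.

Set Implicit Arguments.
Unset Strict Implicit.
Unset Printing Implicit Defensive.

Import Order.TTheory GRing.Theory Num.Theory.
Import numFieldNormedType.Exports.

Local Open Scope classical_set_scope.
Local Open Scope card_scope.
Local Open Scope ring_scope.

(** * Comparison of cardinalities through explicit injections *)

Lemma card_le_of_inj T U (A : set T) (B : set U) :
  (exists f : T -> U, (forall x, A x -> B (f x)) /\
     forall x y, A x -> A y -> f x = f y -> x = y) -> A #<= B.
Proof.
move=> [f [fAB finj]].
have fi : {in A &, injective f}.
  by move=> x y /set_mem Ax /set_mem Ay; exact: finj.
rewrite -(card_le_eql (inj_card_eq fi)).
by apply: subset_card_le => _ [x Ax <-]; exact: fAB.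
Qed.

Lemma card_le_ex T U (A : set T) (B : set U) (u : U) : A #<= B ->
  exists f : T -> U, (forall x, A x -> B (f x)) /\
     forall x y, A x -> A y -> f x = f y -> x = y.
Proof.
move=> /card_leP[f].
pose g x : U :=
  if pselect (A x) is left Ax then val (f (SigSub (mem_set Ax))) else u.
exists g; split=> [x Ax|x y Ax Ay]; rewrite /g.
  by case: pselect => // {}Ax; exact: set_valP.
case: pselect => // {}Ax; case: pselect => // {}Ay /val_inj fxy.
have /(congr1 val)// : SigSub (mem_set Ax) = SigSub (mem_set Ay).
by apply: ('inj_f) fxy; rewrite in_setT.
Qed.

(** Copied into the sum type, [A] and [B] become subsets of one type, and a pair of subsets has a
    member of least cardinality. *)
Lemma card_le_total T U (A : set T) (B : set U) : A #<= B \/ B #<= A.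
Proof.
pose A' : set (T + U) := inl @` A; pose B' : set (T + U) := inr @` B.
have AA' : A' #= A by apply: inj_card_eq => x y _ _ [].
have BB' : B' #= B by apply: inj_card_eq => x y _ _ [].
rewrite -(card_le_eql AA') -(card_le_eqr AA').
rewrite -(card_le_eql BB') -(card_le_eqr BB').
have [|[] -> lmin] := @least_cardP _ [set A'; B'].
- by exists A'; left.
- by left; apply: lmin; right.
- by right; apply: lmin; left.
Qed.

Lemma card_leX T T' U U' (A : set T) (A' : set T') (B : set U) (B' : set U') :
  A #<= B -> A' #<= B' -> A `*` A' #<= B `*` B'.
Proof.
move=> AB AB'.
have [->|/set0P[x Ax]] := eqVneq A set0; first by rewrite set0X.
have [->|/set0P[x' Ax']] := eqVneq A' set0; first by rewrite setX0.
have [u] : inhabited U.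
  by have /card_leP[f] := AB; constructor; exact: val (f (SigSub (mem_set Ax))).
have [u'] : inhabited U'.
  have /card_leP[f] := AB'; constructor.
  exact: val (f (SigSub (mem_set Ax'))).
have [f [fB finj]] := card_le_ex u AB.
have [f' [fB' finj']] := card_le_ex u' AB'.
apply: card_le_of_inj; exists (fun z => (f z.1, f' z.2)); split.
  by move=> [y y'] [/= Ay Ay']; split; [exact: fB|exact: fB'].
move=> [y y'] [z z'] [/= Ay Ay'] [/= Az Az'] [fyz fyz'].
by rewrite (finj _ _ Ay Az fyz) (finj' _ _ Ay' Az' fyz').
Qed.

(** * Squares of infinite sets *)

Section square.
Variables (T : Type).
Implicit Types G H N : set (T * T * T).

(* Zorn's lemma is applied to relations [G] between pairs and points that are
   the graph of an injection (possibly multivalued) of the square of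
   [diag G] into [diag G]. *)
Let diag G : set T := [set x | exists z, G ((x, x), z)].

Let squaring (A : set T) G :=
  [/\ diag G `<=` A,
      forall x y, diag G x -> diag G y -> exists z, G ((x, y), z),
      forall x y z, G ((x, y), z) -> [/\ diag G x, diag G y & diag G z] &
      forall u v z, G (u, z) -> G (v, z) -> u = v].

Let squaring_card A G : squaring A G -> diag G `*` diag G #<= diag G.
Proof.
move=> [_ Gtot Gdiag Ginj].
have [->|/set0P[x0 Gx0]] := eqVneq (diag G) set0; first by rewrite set0X.
have /choice[p pG] (u : T * T) :
    exists z, diag G u.1 -> diag G u.2 -> G (u, z).
  have [[G1 G2]|nG] := pselect (diag G u.1 /\ diag G u.2).
    by have [z Gz] := Gtot _ _ G1 G2; exists z; case: u Gz {G1 G2}.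
  by exists x0 => G1 G2; case: nG.
apply: card_le_of_inj; exists p; split.
  move=> [x y] [/= Gx Gy].
  by have [] := Gdiag _ _ _ (pG (x, y) Gx Gy).
move=> u v [u1 u2] [v1 v2] puv.
by apply: Ginj (pG _ u1 u2) _; rewrite puv; exact: pG.
Qed.

(** Take a maximal relation squaring a subset D of [A]. If [A] minus D embeds in D, then [A] embeds
    in the square of D, hence in D. Otherwise [A] minus D contains a copy of D, and the relation can
    be enlarged. *)
Lemma infinite_card_squareset (A : set T) : infinite_set A -> A `*` A #<= A.
Proof.
move=> Ainf; have [a0 Aa0] := infinite_setN0 Ainf.
have /infiniteP/(card_le_ex a0)[f [fA finj]] := Ainf.
have {}finj i j : f i = f j -> i = j by exact: finj.
(* A countable start forces the maximal relation to have infinite domain. *)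
pose G0 : set (T * T * T) :=
  [set w | exists i j, w = (f i, f j, f (pickle (i, j)))].
have G0d x : diag G0 x <-> exists i, x = f i.
  split=> [[z [i [j [-> _ _]]]]|[i ->]]; first by exists i.
  by exists (f (pickle (i, i))), i, i.
have sG0 : squaring A G0.
  split=> [x /G0d[i ->]|x y /G0d[i ->] /G0d[j ->]|x y z [i [j [-> -> ->]]]|].
  - exact: fA.
  - by exists (f (pickle (i, j))), i, j.
  - by split; apply/G0d; eexists.
  - move=> u v z [i [j [-> ->]]] [k [l [-> /finj]]].
    by move=> /(pcan_inj pickleK)[-> ->].
(* Joining [G0] inside the predicate makes the union of the empty chain admissible and keeps [G0]
   inside the relation [G0] with [G] used below. *)
have [|G [sG Gmax]] := @Zorn_bigcup _ [set G | squaring A (G0 `|` G)].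
  move=> F Fs Ftot /=.
  have [->|/set0P[X FX]] := eqVneq F set0; first by rewrite bigcup_set0 setU0.
  have Fmono Y : F Y -> G0 `|` Y `<=` G0 `|` \bigcup_(X in F) X.
    by move=> FY; apply: setUS; exact: bigcup_sup.
  have F1 u : (G0 `|` \bigcup_(X in F) X) u -> exists2 Y, F Y & (G0 `|` Y) u.
    by move=> [G0u|[Y FY Yu]]; [exists X => //; left|exists Y => //; right].
  have F2 u v : (G0 `|` \bigcup_(X in F) X) u ->
      (G0 `|` \bigcup_(X in F) X) v ->
      exists2 Y, F Y & (G0 `|` Y) u /\ (G0 `|` Y) v.
    move=> /F1[Y FY Yu] /F1[Z FZ Zv]; have [YZ|ZY] := Ftot _ _ FY FZ.
      by exists Z => //; split => //; exact: setUS Yu.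
    by exists Y => //; split => //; exact: setUS Zv.
  have dmono Y x : F Y -> diag (G0 `|` Y) x ->
      diag (G0 `|` \bigcup_(X in F) X) x.
    by move=> FY [z Yz]; exists z; exact: Fmono Yz.
  split.
  - move=> x [z /F1[Y FY Yz]]; have [YA _ _ _] := Fs _ FY.
    by apply: YA; exists z.
  - move=> x y [z Fz] [t Ft]; have [Y FY [Yz Yt]] := F2 _ _ Fz Ft.
    have [_ Ytot _ _] := Fs _ FY.
    have [||w Yw] := Ytot x y; [by exists z|by exists t|].
    by exists w; exact: Fmono Yw.
  - move=> x y z /F1[Y FY Yz]; have [_ _ Yd _] := Fs _ FY.
    by have [? ? ?] := Yd _ _ _ Yz; split; exact: dmono FY _.
  - move=> u v z Fu Fv; have [Y FY [Yu Yv]] := F2 _ _ Fu Fv.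
    by have [_ _ _ Yinj] := Fs _ FY; exact: Yinj Yu Yv.
move: sG; set H := G0 `|` G => sH.
have DD := squaring_card sH.
have [HA Htot Hd Hinj] := sH.
suff AD : A #<= diag H.
  apply: card_le_trans (card_leX AD AD) _.
  by apply: card_le_trans DD _; exact: subset_card_le.
have Df i : diag H (f i) by exists (f (pickle (i, i))); left; exists i, i.
have [p [pD pinj]] := card_le_ex a0 DD.
have [DE|ED] := card_le_total (diag H) (A `\` diag H); last first.
  have [e [eD einj]] := card_le_ex a0 ED.
  apply: card_le_trans DD; apply: card_le_of_inj.
  (* The tags [f 0] and [f 1] separate [diag H] from the rest of [A]. *)
  exists (fun x => if pselect (diag H x) then (x, f 0%N) else (e x, f 1%N)).
  split=> [x Ax|x y Ax Ay].
    by case: pselect => Hx; split=> //=; exact: eD.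
  case: pselect => Hx; case: pselect => Hy; case=> // exy; try by move=> /finj.
  by apply: (einj) exy; split.
exfalso.
have [g [gE ginj]] := card_le_ex a0 DE.
have gnD x : diag H x -> ~ diag H (g x) by move=> /gE[].
(* A pair and a block number [i] are coded by one point of the copy of [diag H] under [g]; the
   number keeps the values of the three new blocks apart. *)
pose q x y i := g (p (p (x, y), f i)).
have pD' x y : diag H x -> diag H y -> diag H (p (x, y)).
  by move=> Hx Hy; apply: pD; split.
have qE x y i : diag H x -> diag H y -> ~ diag H (q x y i).
  by move=> Hx Hy; apply: gnD; apply: (pD') => //; exact: pD'.
have qinj x y i x' y' j : diag H x -> diag H y -> diag H x' -> diag H y' ->
    q x y i = q x' y' j -> [/\ x = x', y = y' & i = j].
  move=> Hx Hy Hx' Hy' /ginj => /(_ (pD' _ _ (pD' _ _ Hx Hy) (Df i))).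
  move=> /(_ (pD' _ _ (pD' _ _ Hx' Hy') (Df j))) /pinj.
  move=> /(_ (conj (pD' _ _ Hx Hy) (Df i)) (conj (pD' _ _ Hx' Hy') (Df j))).
  move=> [/(pinj (x, y) (x', y') (conj Hx Hy) (conj Hx' Hy'))[-> ->]].
  by move=> /finj ->.
(* [N] extends [H] from the square of [diag H] to that of its union with the
   disjoint copy [g @` diag H], the three new blocks going into that copy. *)
pose N : set (T * T * T) := [set w | exists x y, [/\ diag H x, diag H y &
  [\/ w = (x, g y, q x y 0%N), w = (g x, y, q x y 1%N) |
      w = (g x, g y, q x y 2%N)]]].
have gDE x y : diag H x -> diag H y -> x <> g y.
  by move=> Hx /gnD nHg xg; apply: nHg; rewrite -xg.
have HN x : diag (H `|` N) x <-> diag H x \/ exists2 y, diag H y & x = g y.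
  split=> [[z [Hz|[x1 [y1 [H1 H2 []]]]]]|[[z Hz]|[y Hy ->]]].
  - by left; exists z.
  - by move=> [-> /(gDE _ _ H1 H2)].
  - by move=> [-> /esym/(gDE _ _ H2 H1)].
  - by move=> [-> _ _]; right; exists x1.
  - by exists z; left.
  - by exists (q y y 2%N); right; exists y, y; split=> //; apply: Or33.
apply: (Gmax (G `|` N)).
  split; first by move=> w Gw; left.
  move=> GN; have HfN : N (g (f 0%N), g (f 0%N), q (f 0%N) (f 0%N) 2%N).
    by exists (f 0%N), (f 0%N); split=> //; apply: Or33.
  apply: (gnD _ (Df 0%N)); exists (q (f 0%N) (f 0%N) 2%N); right.
  by apply: GN; right.
rewrite /= setUA -/H; split.
- by move=> x /HN[/HA//|[y Hy ->]]; have [] := gE _ Hy.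
- move=> x y /HN[Hx|[x' Hx' ->]] /HN[Hy|[y' Hy' ->]].
  + by have [z Hz] := Htot _ _ Hx Hy; exists z; left.
  + by exists (q x y' 0%N); right; exists x, y'; split=> //; apply: Or31.
  + by exists (q x' y 1%N); right; exists x', y; split=> //; apply: Or32.
  + by exists (q x' y' 2%N); right; exists x', y'; split=> //; apply: Or33.
- have HNg x : diag H x -> diag (H `|` N) (g x).
    by move=> Hx; apply/HN; right; exists x.
  have HNH x : diag H x -> diag (H `|` N) x by move=> Hx; apply/HN; left.
  move=> x y z [/Hd[Hx Hy Hz]|]; first by split; exact: HNH.
  have HNq i x1 y1 : diag H x1 -> diag H y1 -> diag (H `|` N) (q x1 y1 i).
    by move=> H1 H2; apply: (HNg); apply: (pD') => //; exact: pD'.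
  by move=> [x1 [y1 [Hx Hy []]]] [-> -> ->]; split;
    [exact: HNH|exact: HNg|exact: HNq|exact: HNg|exact: HNH|exact: HNq|
     exact: HNg|exact: HNg|exact: HNq].
- have NE u z : N (u, z) -> ~ diag H z.
    by move=> [x [y [Hx Hy []]]] [_ ->]; exact: qE.
  move=> u v z [Hu|Nu] [Hv|Nv]; first exact: Hinj Hu Hv.
  + by case: u Hu => x y /Hd[_ _ /(NE _ _ Nv)].
  + by case: v Hv => x y /Hd[_ _ /(NE _ _ Nu)].
  case: Nu Nv => x [y [Hx Hy Nu]] [x' [y' [Hx' Hy' Nv]]].
  case: Nu Nv => -[-> ->]; case=> -[->];
    by move=> /(qinj _ _ _ _ _ _ Hx Hy Hx' Hy')[-> ->].
Qed.

End square.

(** * Compactness and countable ranges *)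

(** If [P C] failed, the sets [U] for which [P] holds of [C] minus [U] would form a proper filter
    containing [C], and a cluster point in [C] would contradict the local hypothesis. *)
Lemma compact_ind (T : topologicalType) (C : set T) (P : set T -> Prop) :
  compact C -> P set0 -> (forall A B, A `<=` B -> P B -> P A) ->
  (forall A B, P A -> P B -> P (A `|` B)) ->
  (forall x, C x -> exists2 U, nbhs x U & P U) -> P C.
Proof.
move=> cC P0 Psub PU Ploc; apply: contrapT => nPC.
pose F : set_system T := [set U | P (C `\` U)].
have FF : ProperFilter F.
  apply: Build_ProperFilter_ex => [B FB|].
    apply: contrapT => nB; apply: nPC; apply: Psub FB => x Cx; split=> // Bx.
    by apply: nB; exists x.
  split=> [|A B FA FB|A B AB FA].
  - by rewrite /F/= setDT.
  - by rewrite /F/= setDIr; exact: PU.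
  - by apply: Psub FA => x [Cx nBx]; split=> // /AB.
have [|x [Cx clx]] := cC F FF; first by rewrite /F/= setDv.
have [U xU PUU] := Ploc _ Cx.
have [|y [ny /ny]] // := clx (~` U) U _ xU.
by apply: Psub PUU => y [_ /contrapT].
Qed.

Lemma scattered_countable_range (R : realType) (K : compactType)
    (f : Cspace R K) :
  hausdorff_space K -> scattered K -> countable (range f).
Proof.
move=> hK sK.
pose small (U : set K) := countable (f @` U).
have small0 : small set0 by rewrite /small image_set0; exact: countable0.
have smallS A B : A `<=` B -> small B -> small A.
  move=> AB; apply: sub_countable; apply: subset_card_le.
  exact: image_subset.
have smallI (F : nat -> set K) :
    (forall i, small (F i)) -> small (\bigcup_i F i).
  move=> sF; rewrite /small image_bigcup.
  by apply: bigcup_countable => [|i _]; [exact: countableP|exact: sF].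
have smallU A B : small A -> small B -> small (A `|` B).
  by move=> sA sB; rewrite -bigcup2E; apply: smallI => -[|[|i]].
(* If [A] were not empty, an isolated point [x] of [A] would have a closed
   neighborhood [W] with [W `\ x] a countable union of compact sets, each
   covered by finitely many open sets with countable image. *)
pose A : set K := [set x | forall U, nbhs x U -> ~ small U].
have [A0|/eqP/set0P/sK[x [/set_mem Ax [V xV VA]]]] := pselect (A = set0);
  last first.
  have [W xW WV] := compact_regular hK (@compactT K) filterT xV.
  (* [C n] omits [x], and [closure W] meets [A] at most in [x], so every point of [C n] has a
     neighborhood with countable image. *)
  pose C n := closure W `&` [set z | n.+1%:R^-1 <= `|f z - f x|].
  have cC n : closed (C n).
    apply: closedI; first exact: closed_closure.
    apply: (@closed_comp _ _ (fun z => `|f z - f x|) [set r : R | _ <= r]).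
      move=> z _; apply: cvg_norm; apply: cvgB; last exact: cvg_cst.
      exact: Cspace_continuous.
    exact: closed_ge.
  have sC n : small (C n).
    have cptC : compact (C n).
      exact: subclosed_compact (cC n) (@compactT K) _.
    apply: (compact_ind (P := small) cptC) => //.
    move=> z [Wz fz]; apply: contrapT => nz.
    have : [set x] z.
      by rewrite -VA; split; [exact: WV|move=> U zU sU; apply: nz; exists U].
    move=> zx; move: fz; rewrite /= zx subrr normr0 invr_le0.
    by rewrite leNgt ltr0Sn.
  exfalso; apply: (Ax _ xW).
  apply: (smallS _ ((\bigcup_n C n) `|` [set z | f z = f x])).
    move=> z Wz; have [fzx|fz] := eqVneq (f z) (f x); [by right|left].
    have : 0 < `|f z - f x| by rewrite normr_gt0 subr_eq0.
    move=> /ltr_add_invr[n]; rewrite add0r => /ltW fzn.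
    by exists n => //; split=> //; exact: subset_closure.
  apply: smallU; first exact: smallI.
  apply: sub_countable (countable1 (f x)).
  by apply: subset_card_le => _ [z ? <-].
apply: (compact_ind (P := small) (@compactT K)) => // x _.
apply: contrapT => nx; suff : A x by rewrite A0.
by move=> U xU sU; apply: nx; exists U.
Qed.

(** * Separating functions and the lower bound on the density *)

Section urysohn.
Variables (R : realType) (K : compactType).
Hypothesis hK : hausdorff_space K.

Lemma Cspace_bump (x : K) (V : set K) : nbhs x V ->
  exists f : Cspace R K, f x = 1 /\ forall y, ~ V y -> f y = 0.
Proof.
rewrite nbhsE => -[U [oU Ux] UV].
have cx : closed [set x].
  exact: accessible_closed_set1 (hausdorff_accessible hK) x.
have Ux0 : ~` U `&` [set x] = set0.
  by apply/seteqP; split=> // y [nUy yx]; apply: nUy; rewrite yx.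
have := normal_uniform_separator (compact_normal hK (@compactT K))
  (open_closedC oU) cx Ux0.
move=> /(@uniform_separatorP _ R)[g [cg _ g0 g1]].
exists (Cmk cg); split; first by apply: g1; exists x.
by move=> y nVy; apply: g0; exists y => // /UV.
Qed.

Lemma Cspace_separates (x y : K) : x <> y ->
  exists f : Cspace R K, f x = 0 /\ f y = 1.
Proof.
move=> xy; have yx : nbhs y (~` [set x]).
  apply: open_nbhs_nbhs; split; last exact/nesym.
  apply: closed_openC; apply: accessible_closed_set1.
  exact: hausdorff_accessible.
have [f [fy f0]] := Cspace_bump yx.
by exists f; split => //; apply: f0 => /(_ erefl).
Qed.

Lemma card_le_dense_Cspace (D : set (Cspace R K)) :
  scattered K -> dense D -> [set: K] #<= D.
Proof.
move=> sK dD.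
(* [G (x, f)] means that [f > 1 / 2] is a basic open set reserved for [x];
   since it lies in [dom G], it differs from the one reserved later for an
   isolated point of the complement of [dom G]. *)
pose dom (G : set (K * Cspace R K)) : set K := [set x | exists f, G (x, f)].
pose P (G : set (K * Cspace R K)) := forall x f, G (x, f) ->
  [/\ D f, 1 / 2 < f x, forall y, 1 / 2 < f y -> dom G y &
      forall y, G (y, f) -> y = x].
have [|G [PG Gmax]] := @Zorn_bigcup _ P.
  move=> F FP Ftot.
  move=> x f [A FA /= Axf]; have [Df fx fdom finj] := FP _ FA _ _ Axf.
  split=> // [y /fdom[g Ag]|y [B FB Byf]]; first by exists g, A.
  have [AB|BA] := Ftot _ _ FA FB; last by apply: finj; exact: BA.
  have [_ _ _ Binj] := FP _ FB _ _ Byf.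
  by apply/esym/Binj; exact: AB.
have domT : dom G = [set: K].
  apply: contrapT => nT.
  have : ~` dom G !=set0.
    by apply/set0P/eqP => /(congr1 setC); rewrite setCK setC0.
  move=> /sK[x [/set_mem Gx [V xV VG]]].
  (* An [h] in [D] within 1/2 of the bump [g] exceeds 1/2 at [x], and elsewhere only at points of
     [V], which lie in [dom G] unless equal to [x]. So [(x, h)] can be added to [G]. *)
  have [g [gx g0]] := Cspace_bump xV.
  have [h [gh Dh]] : (ball g (1 / 2) `&` D) !=set0.
    have [|h [gh Dh]] := dD (ball g (1 / 2))° _ (open_interior _).
      by exists g; apply: nbhsx_ballx; rewrite divr_gt0.
    by exists h; split => //; exact: interior_subset gh.
  have {}gh y : `|g y - h y| < 1 / 2.
    move: gh; rewrite -ball_normE; apply: le_lt_trans.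
    exact: (Cnorm_ub (g - h)).
  have hx : 1 / 2 < h x by have := gh x; rewrite gx; case: ltrgt0P; lra.
  have hV y : 1 / 2 < h y -> dom G y \/ y = x.
    move=> hy; have [|nGy] := pselect (dom G y); [by left|right].
    suff : [set x] y by [].
    rewrite -VG; split=> //; apply: contrapT => /g0 gy.
    by have := gh y; rewrite gy sub0r normrN; have := ler_norm (h y); lra.
  apply: (Gmax (G `|` [set (x, h)])).
    split; first by move=> z Gz; left.
    by move=> /(_ (x, h) (or_intror erefl)) Gxh; apply: Gx; exists h.
  move=> y f [Gyf|[-> ->]].
    have [Df fy fdom finj] := PG _ _ Gyf; split=> //.
      by move=> z /fdom[k Gzk]; exists k; left.
    by move=> z [/finj//|[-> fh]]; case: Gx; apply: fdom; rewrite fh.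
  split=> //.
    by move=> z /hV[[k Gzk]|->]; [exists k; left|exists h; right].
  move=> z [Gzh|[]//]; have [_ _ /(_ x hx) Gx' _] := PG _ _ Gzh.
  by case: Gx.
have /choice[f fG] x : exists f, G (x, f).
  by have : dom G x by rewrite domT.
have finj : {in [set: K] &, injective f}.
  move=> x y _ _ fxy; have [_ _ _ Ginj] := PG _ _ (fG x).
  by apply/esym/Ginj; rewrite fxy.
rewrite -(card_le_eql (inj_card_eq finj)).
by apply: subset_card_le => _ [x _ <-]; have [] := PG _ _ (fG x).
Qed.

End urysohn.

(** * Lattice approximation and the upper bound on the density *)

(** The generated lattice is the image of these formal words, so its size is bounded by counting
    words. *)
Inductive lattice_term (L : Type) : Type :=
  | Gen of L
  | Meet of lattice_term L & lattice_term L
  | Join of lattice_term L & lattice_term L.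

(** An injective pairing on [M] codes words recursively, with three tags for the constructors. *)
Lemma card_lattice_term (L M : Type) : infinite_set [set: M] ->
  [set: L] #<= [set: M] -> [set: lattice_term L] #<= [set: M].
Proof.
move=> Minf LM; have [m0 _] := infinite_setN0 Minf.
have /(card_le_ex m0)[p [_ pinj]] := infinite_card_squareset Minf.
have {}pinj x y x' y' : p (x, y) = p (x', y') -> x = x' /\ y = y'.
  by move=> pxy; have [] := pinj (x, y) (x', y') (conj Logic.I Logic.I)
    (conj Logic.I Logic.I) pxy.
have /infiniteP/(card_le_ex m0)[f [_ finj]] := Minf.
have {}finj i j : f i = f j -> i = j by exact: finj.
have [l [_ linj]] := card_le_ex m0 LM.
have {}linj x y : l x = l y -> x = y by exact: linj.
pose fix code (t : lattice_term L) : M := match t with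
  | Gen x => p (f 0%N, l x)
  | Meet s t => p (f 1%N, p (code s, code t))
  | Join s t => p (f 2%N, p (code s, code t))
  end.
apply: card_le_of_inj; exists code; split=> // s t _ _.
elim: s t => [x|s IHs s' IHs'|s IHs s' IHs'] [y|t t'|t t'] /pinj[/finj//= _].
- by move=> /linj->.
- by move=> /pinj[/IHs-> /IHs'->].
- by move=> /pinj[/IHs-> /IHs'->].
Qed.

Section lattice_approximation.
Variables (R : realType) (K : compactType).
Local Notation CK := (Cspace R K).
Implicit Types f g : CK.

Lemma Cspace_min_continuous f g : continuous (fun x => Num.min (f x) (g x)).
Proof. by move=> x; apply: continuous_min; exact: Cspace_continuous. Qed.

Lemma Cspace_max_continuous f g : continuous (fun x => Num.max (f x) (g x)).
Proof. by move=> x; apply: continuous_max; exact: Cspace_continuous. Qed.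

Fixpoint lattice_eval (L : Type) (e : L -> CK) (t : lattice_term L) : CK :=
  match t with
  | Gen x => e x
  | Meet s t =>
      Cmk (@Cspace_min_continuous (lattice_eval e s) (lattice_eval e t))
  | Join s t =>
      Cmk (@Cspace_max_continuous (lattice_eval e s) (lattice_eval e t))
  end.

Lemma Cspace_near_lt f (x : K) (a : R) :
  f x < a -> exists2 U, nbhs x U & forall z, U z -> f z < a.
Proof.
move=> fxa; exists [set z | f z < a] => //.
exact: (cvgr_lt _ (@Cspace_continuous _ _ f x) _ fxa).
Qed.

(** Generators that interpolate at two points suffice: a finite meet stays below [g + d / 2]
    everywhere and above [g - d / 2] at a given point, and a finite join of such meets is close to
    [g] everywhere. The finite covers are hidden in [compact_ind]. *)
Lemma lattice_dense (L : Type) (e : L -> CK) (x0 : K) :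
  (forall g (x y : K) (d : R), 0 < d ->
    exists l, `|e l x - g x| < d /\ `|e l y - g y| < d) ->
  dense (range (lattice_eval e)).
Proof.
move=> eP O [g Og] Oo.
have /(nbhs_ballP g)[d /= d0 dO] : nbhs g O by apply: open_nbhs_nbhs.
have d2 : 0 < d / 2 by rewrite divr_gt0.
have upper x : exists t, g x - d / 2 < lattice_eval e t x /\
    forall z, lattice_eval e t z < g z + d / 2.
  pose P (U : set K) := exists t, g x - d / 2 < lattice_eval e t x /\
    forall z, U z -> lattice_eval e t z < g z + d / 2.
  suff [t [tx tz]] : P setT by exists t; split=> // z; exact: tz.
  apply: (compact_ind (@compactT K)).
  - have [l [lx _]] := eP g x x _ d2.
    by exists (Gen l); split=> //=; move: lx; rewrite ltr_distl => /andP[].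
  - by move=> A B AB [t [tx tB]]; exists t; split=> // z /AB; exact: tB.
  - move=> A B [s [sx sA]] [t [tx tB]]; exists (Meet s t); split=> [|z].
      by rewrite /= lt_min sx.
    by move=> [/sA|/tB] h; rewrite /= gt_min h ?orbT.
  - move=> y _; have [l [lx ly]] := eP g x y _ d2.
    have [|U yU UP] := @Cspace_near_lt (e l - g) y (d / 2).
      by apply: le_lt_trans ly; exact: ler_norm.
    exists U => //; exists (Gen l); split=> /=.
      by move: lx; rewrite ltr_distl => /andP[].
    by move=> z /UP elz; rewrite -ltrBlDl.
pose P (U : set K) := exists t,
  (forall z, U z -> g z - d / 2 < lattice_eval e t z) /\
  forall z, lattice_eval e t z < g z + d / 2.
have [t [tl tu]] : P setT.
  apply: (compact_ind (@compactT K)).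
  (* There is no empty join, so the empty set also needs a word; [x0] supplies one. *)
  - by have [t [_ tu]] := upper x0; exists t.
  - by move=> A B AB [t [tl tB]]; exists t; split=> // z /AB; exact: tl.
  - move=> A B [s [sA su]] [t [tB tu]]; exists (Join s t); split=> z.
      by move=> [/sA|/tB] h; rewrite /= lt_max h ?orbT.
    by rewrite /= gt_max su tu.
  - move=> x _; have [t [tx tu]] := upper x.
    have [|U xU UP] := @Cspace_near_lt (g - lattice_eval e t) x (d / 2).
      by rewrite -[ltLHS]/(g x - lattice_eval e t x) ltrBlDr -ltrBlDl.
    exists U => //; exists t; split=> // z /UP gtz.
    by rewrite ltrBlDr -ltrBlDl.
exists (lattice_eval e t); split; last by exists t.
apply: dO; rewrite -ball_normE /=.
apply: (@le_lt_trans _ _ (d / 2)); last by lra.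
apply: Cnorm_le => [|z]; first exact: ltW.
rewrite -[X in `|X|]/(g z - lattice_eval e t z).
by rewrite ler_distlC !ltW// tl.
Qed.

End lattice_approximation.

(** The bound is an arbitrary infinite [M], so that finite [K] is covered as well, with [nat] for
    [M]. *)
Lemma card_dens_Cspace_le (R : realType) (K : compactType) (M : Type) :
  hausdorff_space K -> infinite_set [set: M] -> [set: K] #<= [set: M] ->
  dens (Cspace R K) #<= [set: M].
Proof.
move=> hK Minf KM; have [m0 _] := infinite_setN0 Minf.
suff [D dD DM] : exists2 D : set (Cspace R K), dense D & D #<= [set: M].
  have [|_ leD] := @least_cardP _ (@dense (Cspace R K)); first by exists D.
  exact: card_le_trans (leD _ dD) DM.
have [[x0]|K0] := pselect (inhabited K); last first.
  exists setT; first by move=> O [f Of] _; exists f.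
  apply: card_le_of_inj; exists (fun=> m0); split=> // f g _ _ _.
  by apply: CspaceP => x; case: K0.
have /choice[b bP] (w : K * K) :
    exists f : Cspace R K, w.1 <> w.2 -> f w.1 = 0 /\ f w.2 = 1.
  have [w12|] := eqVneq w.1 w.2; first by exists 0 => /(_ w12).
  by move=> /eqP /(Cspace_separates R hK)[f fP]; exists f.
have cst1 : continuous (fun _ : K => 1 : R) by move=> x; exact: cvg_cst.
pose e (l : (K * K) * (rat * rat)) : Cspace R K :=
  ratr l.2.1 *: Cmk cst1 + ratr l.2.2 *: b l.1.
have eE l z : e l z = ratr l.2.1 + ratr l.2.2 * b l.1 z.
  by rewrite -[LHS]/(_ * 1 + _) mulr1.
exists (range (lattice_eval e)).
  apply: lattice_dense => // g x y d d0.
  have near_rat (r : R) : exists q : rat, `|ratr q - r| < d.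
    have [|q] := @rat_in_itvoo R (r - d) (r + d); first lra.
    by rewrite in_itv/= => /andP[? ?]; exists q; rewrite ltr_distl; lra.
  have [q qx] := near_rat (g x).
  (* For equal points [b] is unspecified, and the coefficient 0 removes it; otherwise [q] fixes the
     value at [x] and [r] corrects the one at [y]. *)
  have [<-|/eqP xy] := eqVneq x y.
    by exists ((x, x), (q, 0)); rewrite !eE/= raddf0 mul0r addr0.
  have [r ry] := near_rat (g y - ratr q).
  exists ((x, y), (q, r)); rewrite !eE/=.
  have [-> ->] := bP (x, y) xy; rewrite mulr0 addr0 mulr1; split=> //.
  by move: ry; rewrite opprB addrA [ratr r + _]addrC.
apply: card_le_trans (card_image_le _ _) _.
apply: card_lattice_term => //.
have MM := infinite_card_squareset Minf.
have QM : [set: rat] #<= [set: M].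
  apply: (@card_le_trans _ _ _ [set: nat]); last exact/infiniteP.
  exact: countableP.
rewrite -!setXTT; apply: card_le_trans MM.
apply: card_leX; apply: card_le_trans (infinite_card_squareset Minf);
  exact: card_leX.
Qed.

(** * Initial ordinals and cofinality *)

Section cardinal.
Variable kappa : cardinal.
Implicit Types a b c : kappa.

Let seg a : set kappa := [set b | cle b a /\ b <> a].

(** The order axioms below come from unique least elements of sets with at most three points. *)
Let cle_least (P : set kappa) : P !=set0 ->
  exists2 a, P a & forall b, P b -> cle a b.
Proof.
move=> [a Pa]; have [|z [[/asboolP Pz zmin] _]] :=
  @cle_wo kappa (fun x => `[< P x >]); first by exists a; apply/asboolP.
by exists z => // b Pb; apply: zmin; apply/asboolP.
Qed.

Let clexx a : cle a a.
Proof. by have [|b ->] := @cle_least [set a]; [exists a|apply]. Qed.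

Let cle_anti a b : cle a b -> cle b a -> a = b.
Proof.
move=> ab ba.
have [|z [_ zuniq]] := @cle_wo kappa (fun x => `[< x = a \/ x = b >]).
  by exists a; apply/asboolP; left.
have za : z = a.
  by apply: zuniq; split=> [|c /asboolP[]->//]; apply/asboolP; left.
by rewrite -za; apply: zuniq; split=> [|c /asboolP[]->//]; apply/asboolP; right.
Qed.

Let cle_total a b : cle a b \/ cle b a.
Proof.
have [|c [->|->] cmin] := @cle_least [set a; b]; first by exists a; left.
- by left; apply: cmin; right.
- by right; apply: cmin; left.
Qed.

Let cle_trans a b c : cle a b -> cle b c -> cle a c.
Proof.
move=> ab bc.
have [|d [[->|->]|->] dmin] := @cle_least [set a; b; c].
- by exists a; left; left.
- by apply: dmin; right.
- by have -> : a = b by apply: cle_anti => //; apply: dmin; left; left.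
- by have <- : b = c by apply: cle_anti => //; apply: dmin; left; right.
Qed.

(** A maximal partial bijection cannot reach all of [kappa], which would then embed in [S]. With [a]
    the least value missed, it is defined on all of [S], since otherwise some [(s, a)] could be
    added. *)
Lemma card_le_segment T (S : set T) : ~ ([set: kappa] #<= S) ->
  exists a, S #<= seg a.
Proof.
move=> nS.
(* [P G]: [G] is the graph of a bijection from a part of [S] onto an initial
   segment of [kappa]. *)
pose P (G : set (T * kappa)) := [/\ forall s a, G (s, a) -> S s,
  forall s a b, G (s, a) -> G (s, b) -> a = b,
  forall s t a, G (s, a) -> G (t, a) -> s = t &
  forall s a b, G (s, a) -> cle b a -> exists t, G (t, b)].
have [|G [[Gdom Gfun Ginj Gseg] Gmax]] := @Zorn_bigcup _ P.
  move=> F FP Ftot.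
  have F2 u v : (\bigcup_(X in F) X) u -> (\bigcup_(X in F) X) v ->
      exists X, [/\ F X, X u & X v].
    move=> [X FX Xu] [Y FY Yv]; have [XY|YX] := Ftot _ _ FX FY.
      by exists Y; split=> //; exact: XY.
    by exists X; split=> //; exact: YX.
  split.
  - by move=> s a [X FX Xsa]; have [Xdom _ _ _] := FP _ FX; exact: Xdom Xsa.
  - move=> s a b sa sb; have [X [FX Xsa Xsb]] := F2 _ _ sa sb.
    by have [_ Xfun _ _] := FP _ FX; exact: Xfun Xsa Xsb.
  - move=> s t a sa ta; have [X [FX Xsa Xta]] := F2 _ _ sa ta.
    by have [_ _ Xinj _] := FP _ FX; exact: Xinj Xsa Xta.
  - move=> s a b [X FX Xsa] ba; have [_ _ _ Xseg] := FP _ FX.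
    by have [t Xtb] := Xseg _ _ _ Xsa ba; exists t, X.
have [Gonto|] := pselect (forall b, exists s, G (s, b)).
  have [g gG] := choice Gonto.
  exfalso; apply: nS; apply: card_le_of_inj.
  exists g; split=> [b _|b c _ _ gbc].
    exact: Gdom (gG b).
  by apply: Gfun (gG b) _; rewrite gbc.
move=> /existsNP/(@cle_least)[a nGa amin]; exists a.
have Ga b : seg a b -> exists s, G (s, b).
  move=> [ba bna]; apply: contrapT => /amin ab.
  by apply: bna; exact: cle_anti.
have Gdoma s b : G (s, b) -> seg a b.
  move=> Gsb; have [ab|ba] := cle_total a b.
    by case: nGa; exact: Gseg Gsb ab.
  by split=> // ab; apply: nGa; exists s; rewrite -ab.
have /choice[g gG] s : exists b, S s -> G (s, b).
  apply: contrapT => ns.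
  have Ss : S s by apply: contrapT => nSs; apply: ns; exists a.
  have {}ns b : ~ G (s, b) by move=> Gsb; apply: ns; exists b.
  apply: (Gmax (G `|` [set (s, a)])).
    split; first by move=> u Gu; left.
    by move=> /(_ (s, a) (or_intror erefl)) /ns.
  split.
  - by move=> t b [/Gdom//|[-> _]].
  - move=> t b c [Gb|tb] [Gc|tc]; first exact: Gfun Gb Gc.
    + by case: tc Gb => -> _ /ns.
    + by case: tb Gc => -> _ /ns.
    + by rewrite (congr1 snd tb : b = a) (congr1 snd tc : c = a).
  - move=> t u b [Gt|tb] [Gu|ub]; first exact: Ginj Gt Gu.
    + by case: nGa; exists t; rewrite -(congr1 snd ub : b = a).
    + by case: nGa; exists u; rewrite -(congr1 snd tb : b = a).
    + by rewrite (congr1 fst tb : t = s) (congr1 fst ub : u = s).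
  - move=> t b c [Gtb cb|[_ -> ca]].
      by have [u Gu] := Gseg _ _ _ Gtb cb; exists u; left.
    have [->|cna] := pselect (c = a); first by exists s; right.
    by have [|u Gu] := Ga c; [split|exists u; left].
apply: card_le_of_inj; exists g; split=> [s /gG/Gdoma//|s t /gG Gs /gG Gt gst].
by apply: Ginj Gs _; rewrite gst.
Qed.

Lemma cof_card_le : cof kappa #<= [set: kappa].
Proof. exact: subset_card_le. Qed.

(** An image without strict upper bound would be cofinal. *)
Lemma card_lt_cof_bounded J (I : set J) (a : J -> kappa) : I #< cof kappa ->
  exists b, forall i, I i -> seg b (a i).
Proof.
move=> /andP[_ /negP Icof]; apply: contrapT => nb; apply: Icof.
have [|_ cofle] := @least_cardP _ (@cofinal kappa).
  by exists setT => x; exists x.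
apply: card_le_trans (card_image_le a I); apply: cofle => x.
apply: contrapT => nx; apply: nb; exists x => i Ii.
have [xa|ax] := cle_total x (a i).
  by case: nx; exists (a i) => //; exists i.
by split=> // axE; apply: nx; exists x => //; exists i.
Qed.

(** Each [F i] embeds in a proper segment. Fewer than [cof kappa] bounds have a common bound, so one
    segment receives [I] and every [F i]. *)
Lemma bigcup_card_not_le J T (I : set J) (F : J -> set T) :
  infinite_set I -> I #< cof kappa ->
  (forall i, I i -> ~ ([set: kappa] #<= F i)) ->
  ~ ([set: kappa] #<= \bigcup_(i in I) F i).
Proof.
move=> Iinf Icof Fsmall kF.
have Ik : I #<= [set: kappa].
  by case/andP: Icof => leIcof _; exact: card_le_trans leIcof cof_card_le.
have [a0 _] : [set: kappa] !=set0.
  by apply: infinite_setN0 => /(card_le_finite Ik).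
have [h [_ hinj]] := card_le_ex a0 Ik.
have /choice[a aP] i : exists a, I i -> F i #<= seg a.
  have [/Fsmall/card_le_segment[a Fa]|nIi] := pselect (I i); first by exists a.
  by exists a0.
have [u aseg] := card_lt_cof_bounded a Icof.
have [v hseg] := card_lt_cof_bounded h Icof.
have segS b c d : cle c d -> seg c b -> seg d b.
  move=> cd [bc bnc]; split; first exact: cle_trans bc cd.
  by move=> bd; apply: bnc; apply: cle_anti bc _; rewrite bd.
have [w [uw vw]] : exists w, cle u w /\ cle v w.
  by have [uv|vu] := cle_total u v; [exists v|exists u].
have Iw : I #<= seg w.
  apply: card_le_of_inj; exists h; split=> // i Ii.
  by apply: segS vw _; exact: hseg.
have /choice[f fP] i : exists f : T -> kappa, I i ->
    (forall t, F i t -> seg w (f t)) /\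
    forall s t, F i s -> F i t -> f s = f t -> s = t.
  have [Ii|nIi] := pselect (I i); last by exists (fun=> a0).
  have [f [fseg finj]] := card_le_ex a0 (aP i Ii).
  exists f => _; split=> // t /fseg ft; have [aiu ainu] := aseg _ Ii.
  exact: segS uw (segS _ _ _ aiu ft).
have winf : infinite_set (seg w) by move=> /(card_le_finite Iw).
(* The union embeds in [I] times [seg w], hence in the square of [seg w], hence in [seg w], which is
   smaller than [kappa]. *)
have /andP[_ /negP] := @cle_initial kappa w; apply.
apply: card_le_trans kF _.
apply: card_le_trans (infinite_card_squareset winf).
apply: card_le_trans (card_leX Iw (card_lexx (seg w))).
have [j0 Ij0] := infinite_setN0 Iinf.
have /choice[k kP] t : exists k, (\bigcup_(i in I) F i) t -> I k /\ F k t.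
  have [[k Ik' Fk]|nt] := pselect ((\bigcup_(i in I) F i) t); first by exists k.
  by exists j0.
apply: card_le_of_inj; exists (fun t => (k t, f (k t) t)).
split=> [t /kP[Ikt Fkt]|].
  by split=> //=; have [fseg _] := fP _ Ikt; exact: fseg.
move=> s t /kP[Iks Fks] /kP[Ikt Fkt] [kst].
have [_ finj] := fP _ Ikt; move: Fks; rewrite kst => Fs; exact: finj.
Qed.

End cardinal.

(** * Point evaluations and overcomplete sets *)

Lemma eq_lspan_Cspace (R : realType) (K : compactType) (Z : set (Cspace R K))
    (x y : K) :
  (forall f, Z f -> f x = f y) -> forall f, lspan Z f -> f x = f y.
Proof.
move=> Zxy _ [n [c [z [zZ ->]]]].
apply: (big_ind (fun f : Cspace R K => f x = f y)) => // [f g fxy gxy|i _].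
  by rewrite -[LHS]/(f x + g x) fxy gxy.
rewrite -[LHS]/(c i * z i x) -[RHS]/(c i * z i y).
by congr (_ * _); exact: Zxy.
Qed.

(** A function with values 0 at [x] and 1 at [y] is not within 1/2 of any function taking equal
    values there. *)
Lemma not_linearly_dense_Cspace (R : realType) (K : compactType)
    (Z : set (Cspace R K)) (x y : K) : hausdorff_space K -> x <> y ->
  (forall f, Z f -> f x = f y) -> ~ linearly_dense Z.
Proof.
move=> hK xy /eq_lspan_Cspace Zxy dZ.
have [g [gx gy]] := Cspace_separates R hK xy.
have [|f [/interior_subset gf /Zxy fxy]] :=
  dZ (ball g (1 / 2))° _ (open_interior _).
  by exists g; apply: nbhsx_ballx; rewrite divr_gt0.
have {}gf z : `|g z - f z| < 1 / 2.
  move: gf; rewrite -ball_normE; apply: le_lt_trans.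
  exact: (Cnorm_ub (g - f)).
have := gf x; have := gf y; rewrite gx gy fxy !ltr_distl.
move=> /andP[? ?] /andP[? ?].
clear xy; lra.
Qed.

Theorem theorem40 (R : realType) (kappa : cardinal) (K : compactType)
    (hkappa : omega1 #< cof kappa)
    (K_hausdorff : hausdorff_space K)
    (K_scattered : scattered K) :
  ([set: K] #= [set: kappa] <-> dens (Cspace R K) #= [set: kappa]) /\
  ([set: K] #= [set: kappa] ->
   ~ exists Y : set (Cspace R K), overcomplete Y).
Proof.
have [omega1_unctbl _] := omega1P.
have omega1_inf : infinite_set omega1 by move=> /finite_set_countable.
have omega1_le : omega1 #<= [set: kappa].
  by case/andP: hkappa => le _; exact: card_le_trans le (cof_card_le kappa).
have kappa_unctbl : ~ countable [set: kappa].
  by move=> /(card_le_trans omega1_le).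
have dens_dense : dense (dens (Cspace R K)).
  have [] // := @least_cardP _ (@dense (Cspace R K)).
  by exists setT => O [f Of] _; exists f.
have K_dens : [set: K] #<= dens (Cspace R K) by exact: card_le_dense_Cspace.
have dens_K : infinite_set [set: K] -> dens (Cspace R K) #<= [set: K].
  by move=> Kinf; exact: card_dens_Cspace_le.
have Kinf : [set: K] #= [set: kappa] -> infinite_set [set: K].
  by move=> Kk /finite_set_countable; rewrite /countable (card_le_eql Kk).
have dens_kappa : [set: K] #= [set: kappa] -> dens (Cspace R K) #= [set: kappa].
  move=> Kk; apply: card_eq_trans (Kk); apply/card_eqPle; split=> //.
  exact: dens_K (Kinf Kk).
split; first split=> // densk.
  apply/card_eqPle; rewrite -(card_le_eql densk) -(card_le_eqr densk).
  split=> //.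
  (* A finite [K] would make the density countable. *)
  apply: dens_K => /finite_set_countable Kctbl; apply: kappa_unctbl.
  rewrite /countable -(card_le_eql densk).
  exact: card_dens_Cspace_le K_hausdorff infinite_nat Kctbl.
move=> Kk [Y [Ydens Yover]].
have Yk : Y #= [set: kappa] := card_eq_trans Ydens (dens_kappa Kk).
have [x0 _] := infinite_setN0 (Kinf Kk).
have omega1K : omega1 #<= [set: K] by rewrite (card_le_eqr Kk).
have [x [_ xinj]] := card_le_ex x0 omega1K.
pose I := omega1 `*` omega1.
(* [F] is empty on the diagonal, so the full square can serve as index set. *)
pose F (ij : set nat * set nat) :=
  [set y | Y y /\ ij.1 <> ij.2 /\ y (x ij.1) = y (x ij.2)].
have Iomega1 : I #<= omega1 by exact: infinite_card_squareset.
have Iinf : infinite_set I.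
  apply: contra_not omega1_inf; apply: card_le_finite.
  by apply: card_le_of_inj; exists (fun i => (i, i)); split=> // i j _ _ [].
have Icof : I #< cof kappa.
  case/andP: hkappa => le nle; apply/andP; split; first exact: card_le_trans le.
  by apply: contra nle => /card_le_trans; apply.
have Fsmall ij : I ij -> ~ ([set: kappa] #<= F ij).
  case: ij => i j [/= oi oj] kF.
  have FY : F (i, j) `<=` Y by move=> y [].
  have {}kF : F (i, j) #= Y.
    apply/card_eqPle; rewrite (card_le_eql Yk).
    by split=> //; exact: subset_card_le.
  have [ij|ij] := pselect (i = j).
    have F0 : F (i, j) = set0 by apply/seteqP; split=> // y [_ []].
    apply: kappa_unctbl; rewrite /countable (card_le_eql (card_esym Yk)).
    by rewrite -(card_le_eql kF) F0.
  have xij : x i <> x j by move=> /(xinj _ _ oi oj).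
  apply: (not_linearly_dense_Cspace K_hausdorff xij _ (Yover _ FY kF)).
  by move=> f [_ []].
have := bigcup_card_not_le Iinf Icof Fsmall; apply.
rewrite -(card_le_eql Yk); apply: subset_card_le => y Yy.
(* An element [y] outside every [F] is injective on the chosen points, so [omega1] embeds in its
   countable range. *)
apply: contrapT => nFy.
apply: omega1_unctbl.
apply: card_le_trans (scattered_countable_range y K_hausdorff K_scattered).
apply: card_le_of_inj; exists (fun i => y (x i)); split=> [i _|i j oi oj yij].
  by exists (x i).
by apply: contrapT => ij; apply: nFy; exists (i, j).
Qed.
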